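(* Let $C \subset \mathbb{H}^d$ be a convex body and let $H$ be any supporting hyperplane of $C$. Then $\mathrm{width}_H (C)$ equals the maximum distance between $H$ and a point of $C$.
   Context: $\mathbb{H}^d$ is the $d$-dimensional hyperbolic space, and $|ab|$ is the hyperbolic distance of points $a,b$. A set is convex if with every two points it contains the geodesic segment joining them. A convex body in $\mathbb{H}^d$ is a closed bounded convex set with non-empty interior. A hyperplane $H$ supports a convex body $C$ if $H$ has a common point with $C$ and $H$ is disjoint from the interior of $C$. For non-empty sets $A,B$, $\mathrm{dist}(A,B)$ is the infimum of $|ab|$ over $a\in A$, $b\in B$; the distance of a point $c$ from $H$ is $\mathrm{dist}(\{c\},H)$. Two hyperplanes are ultraparallel if they do not intersect in a real or imaginary point (that is, they meet neither in $\mathbb{H}^d$ nor at infinity). For a hyperplane $H$ supporting a convex body $C$, the width $\mathrm{width}_H(C)$ of $C$ determined by $H$ is the distance $\mathrm{dist}(H,J)$ between $H$ and any farthest (from $H$) hyperplane $J$ among those ultraparallel to $H$ and supporting $C$. *)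

(* Defs.v *)
From HB Require Import structures.
From mathcomp Require Import all_boot all_order all_algebra.
From mathcomp Require Import all_classical all_reals all_analysis.
From mathcomp Require Import ring lra.

Set Implicit Arguments.
Unset Strict Implicit.
Unset Printing Implicit Defensive.

Import Order.TTheory GRing.Theory Num.Theory.
Import numFieldNormedType.Exports.

Local Open Scope classical_set_scope.
Local Open Scope ring_scope.

(* Coordinate 0 is the time coordinate of Minkowski space R^{1,d}. *)
Definition lorentz (R : realType) (d : nat) (u v : 'rV[R]_d.+1) : R :=
  \sum_(i < d) u 0 (lift ord0 i) * v 0 (lift ord0 i) - u 0 0 * v 0 0.

(* Hyperboloid model: the upper sheet of <x, x> = -1. *)
Record hspace (R : realType) (d : nat) := HPoint {
  hcoord :> 'rV[R]_d.+1;
  hcoordP : (lorentz hcoord hcoord == -1) && (0 < hcoord 0 0)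
}.

HB.instance Definition _ (R : realType) (d : nat) :=
  [isSub for @hcoord R d].
HB.instance Definition _ (R : realType) (d : nat) :=
  [Choice of hspace R d by <:].

Definition arcosh (R : realType) (t : R) : R :=
  ln (t + Num.sqrt (t ^+ 2 - 1)).

Definition hdist (R : realType) (d : nat) (x y : hspace R d) : R :=
  arcosh (- lorentz x y).

Section hdist_metric.
Context (R : realType) (d : nat).
Implicit Types (u v w : 'rV[R]_d.+1) (x y z : hspace R d).

Lemma lorentzC u v : lorentz u v = lorentz v u.
Proof.
rewrite /lorentz (mulrC (u 0 0)).
by under eq_bigr do rewrite mulrC.
Qed.

Lemma lorentzDl u v w : lorentz (u + v) w = lorentz u w + lorentz v w.
Proof.
rewrite /lorentz !mxE mulrDl opprD addrACA -big_split /=; congr (_ + _).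
by apply: eq_bigr => i _; rewrite !mxE mulrDl.
Qed.

Lemma lorentzZl (a : R) u w : lorentz (a *: u) w = a * lorentz u w.
Proof.
rewrite /lorentz !mxE mulrBr mulr_sumr mulrA; congr (_ + _).
by apply: eq_bigr => i _; rewrite !mxE mulrA.
Qed.

Lemma lorentzDr u v w : lorentz w (u + v) = lorentz w u + lorentz w v.
Proof. by rewrite lorentzC lorentzDl !(lorentzC w). Qed.

Lemma lorentzZr (a : R) u w : lorentz w (a *: u) = a * lorentz w u.
Proof. by rewrite lorentzC lorentzZl (lorentzC w). Qed.

Lemma hspace_lorentz x : lorentz x x = -1.
Proof. by have /andP[/eqP] := hcoordP x. Qed.

Lemma hspace_gt0 x : 0 < (x : 'rV[R]_d.+1) 0 0.
Proof. by have /andP[] := hcoordP x. Qed.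

Lemma euclid_CS (a b : 'I_d -> R) :
  (\sum_i a i * b i) ^+ 2 <= (\sum_i a i ^+ 2) * (\sum_i b i ^+ 2).
Proof.
set ab := \sum_i a i * b i; set aa := \sum_i a i ^+ 2.
set bb := \sum_i b i ^+ 2.
have bb0 : 0 <= bb by apply: sumr_ge0 => i _; exact: sqr_ge0.
have : 0 <= \sum_i (bb * a i - ab * b i) ^+ 2.
  by apply: sumr_ge0 => i _; exact: sqr_ge0.
have -> : \sum_i (bb * a i - ab * b i) ^+ 2 = bb * (aa * bb - ab ^+ 2).
  under eq_bigr => i _.
    have -> : (bb * a i - ab * b i) ^+ 2 = bb ^+ 2 * a i ^+ 2 +
      (- 2 * bb * ab) * (a i * b i) + ab ^+ 2 * b i ^+ 2 by ring.
    over.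
  by rewrite !big_split /= -!mulr_sumr -/aa -/ab -/bb; ring.
move: bb0; rewrite le_eqVlt => /orP[/eqP bb0 _|bb0]; last first.
  by rewrite pmulr_rge0// subr_ge0.
have b0 i : b i = 0.
  move/esym/eqP: bb0; rewrite psumr_eq0; last by move=> ? _; exact: sqr_ge0.
  by move=> /allP/(_ i); rewrite mem_index_enum sqrf_eq0 => /(_ isT)/eqP.
rewrite -bb0 mulr0 /ab big1 ?expr0n// => i _.
by rewrite b0 mulr0.
Qed.

(* The Lorentz form is positive definite on the orthogonal complement of a
   point of the hyperboloid. *)
Lemma lorentz_orth x u : lorentz u x = 0 ->
  0 <= lorentz u u /\ (lorentz u u = 0 -> u = 0).
Proof.
move=> ux0.
set A := \sum_(i < d) (u 0 (lift ord0 i)) ^+ 2.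
set X := \sum_(i < d) ((x : 'rV[R]_d.+1) 0 (lift ord0 i)) ^+ 2.
set a := u 0 0; set x0 := (x : 'rV[R]_d.+1) 0 0.
have uuE : lorentz u u = A - a ^+ 2.
  by rewrite /lorentz expr2; congr (_ + _); apply: eq_bigr => i _; rewrite expr2.
have XE : X = x0 ^+ 2 - 1.
  have := hspace_lorentz x; rewrite /lorentz -/x0.
  under eq_bigr do rewrite -expr2.
  by rewrite -/X => ?; lra.
have A0 : 0 <= A by apply: sumr_ge0 => i _; exact: sqr_ge0.
have CS : a ^+ 2 * x0 ^+ 2 <= A * (x0 ^+ 2 - 1).
  rewrite -XE -exprMn.
  have <- : \sum_(i < d) u 0 (lift ord0 i) * (x : 'rV[R]_d.+1) 0 (lift ord0 i)
      = a * x0 by apply/eqP; rewrite -subr_eq0; apply/eqP.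
  exact: euclid_CS.
have x02 : 0 < x0 ^+ 2 by rewrite exprn_gt0// hspace_gt0.
have H : 0 <= x0 ^+ 2 * lorentz u u - A by rewrite uuE; lra.
split; first by rewrite -(pmulr_rge0 _ x02); lra.
move=> uu0; have AE : A = 0 by move: H; rewrite uu0 mulr0; lra.
have a0 : a = 0.
  by move: uu0; rewrite uuE AE sub0r => /eqP; rewrite oppr_eq0 sqrf_eq0 => /eqP.
apply/rowP => j; rewrite mxE; case: (unliftP ord0 j) => [i ->|-> //].
move/eqP: AE; rewrite /A psumr_eq0; last by move=> ? _; exact: sqr_ge0.
by move=> /allP/(_ i); rewrite mem_index_enum sqrf_eq0 => /(_ isT)/eqP.
Qed.

Lemma lorentz_CS x u v : lorentz u x = 0 -> lorentz v x = 0 ->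
  lorentz u v ^+ 2 <= lorentz u u * lorentz v v.
Proof.
move=> ux vx.
have [vv0 vv0P] := lorentz_orth vx.
have : lorentz (lorentz v v *: u + (- lorentz u v) *: v) x = 0.
  by rewrite lorentzDl !lorentzZl ux vx !mulr0 addr0.
move=> /lorentz_orth[+ _].
rewrite !(lorentzDl, lorentzDr, lorentzZl, lorentzZr) (lorentzC v u).
have [v0|vvn0] := eqVneq (lorentz v v) 0.
  have uv0 : lorentz u v = 0.
    by rewrite (vv0P v0) -(scale0r (0 : 'rV[R]_d.+1)) lorentzZr mul0r.
  by move=> _; rewrite uv0 v0 mulr0 expr0n lexx.
have vvp : 0 < lorentz v v by rewrite lt_neqAle eq_sym vvn0.
set p := lorentz v v in vvp *; set q := lorentz u v; set r := lorentz u u.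
by move=> h; rewrite -subr_ge0 -(pmulr_rge0 _ vvp); lra.
Qed.

Lemma hspace_lorentz_le x y : 1 <= - lorentz x y.
Proof.
set X := \sum_(i < d) ((x : 'rV[R]_d.+1) 0 (lift ord0 i)) ^+ 2.
set Y := \sum_(i < d) ((y : 'rV[R]_d.+1) 0 (lift ord0 i)) ^+ 2.
set S := \sum_(i < d) (x : 'rV[R]_d.+1) 0 (lift ord0 i) *
                      (y : 'rV[R]_d.+1) 0 (lift ord0 i).
set x0 := (x : 'rV[R]_d.+1) 0 0; set y0 := (y : 'rV[R]_d.+1) 0 0.
have XE : X = x0 ^+ 2 - 1.
  have := hspace_lorentz x; rewrite /lorentz -/x0.
  under eq_bigr do rewrite -expr2.
  by rewrite -/X => ?; lra.
have YE : Y = y0 ^+ 2 - 1.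
  have := hspace_lorentz y; rewrite /lorentz -/y0.
  under eq_bigr do rewrite -expr2.
  by rewrite -/Y => ?; lra.
have X0 : 0 <= X by apply: sumr_ge0 => i _; exact: sqr_ge0.
have Y0 : 0 <= Y by apply: sumr_ge0 => i _; exact: sqr_ge0.
have x0p : 0 < x0 := hspace_gt0 x.
have y0p : 0 < y0 := hspace_gt0 y.
have CS : S ^+ 2 <= X * Y by exact: euclid_CS.
rewrite /lorentz -/x0 -/y0 -/S.
have xy1 : 1 <= x0 * y0.
  have x1 : 1 <= x0 by nra.
  have y1 : 1 <= y0 by nra.
  by rewrite -[1]mulr1 ler_pM.
suff : S <= x0 * y0 - 1 by lra.
have [S0|S0] := ltP S 0; first by lra.
rewrite -(@ler_pXn2r _ 2)// ?nnegrE//; last by lra.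
apply: (le_trans CS); rewrite XE YE.
have := sqr_ge0 (x0 - y0); rewrite -subr_ge0 => h.
by rewrite -subr_ge0; have -> : (x0 * y0 - 1) ^+ 2 - (x0 ^+ 2 - 1) * (y0 ^+ 2 - 1)
   = (x0 - y0) ^+ 2 - 0 by ring.
Qed.

Lemma hdistxx x : hdist x x = 0.
Proof. by rewrite /hdist hspace_lorentz opprK /arcosh expr1n subrr sqrtr0 addr0 ln1. Qed.

Lemma hdistC x y : hdist x y = hdist y x.
Proof. by rewrite /hdist lorentzC. Qed.

Lemma hdist_eq0 x y : hdist x y = 0 -> x = y.
Proof.
move=> h; have A1 := hspace_lorentz_le x y.
have {h} A1' : - lorentz x y = 1.
  apply/eqP; rewrite eq_le A1 andbT.
  have := sqrtr_ge0 ((- lorentz x y) ^+ 2 - 1).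
  move: h; rewrite /hdist /arcosh; set s := Num.sqrt _ => h s0.
  have : - lorentz x y + s = 1.
    by apply: ln_inj; rewrite ?posrE ?ln1//; lra.
  lra.
have E : lorentz ((x : 'rV[R]_d.+1) + (-1) *: (y : 'rV[R]_d.+1)) y = 0.
  by rewrite lorentzDl lorentzZl hspace_lorentz; lra.
have [_ D] := lorentz_orth E.
apply: val_inj => /=; apply/eqP; rewrite -subr_eq0 -scaleN1r; apply/eqP/D.
rewrite !(lorentzDl, lorentzDr, lorentzZl, lorentzZr) !hspace_lorentz.
by rewrite (lorentzC y x); lra.
Qed.

Lemma hdist_triangle y x z : hdist x z <= hdist x y + hdist y z.
Proof.
rewrite /hdist /arcosh.
have := hspace_lorentz_le x y; have := hspace_lorentz_le y z.
have := hspace_lorentz_le x z.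
set A := - lorentz x y; set B := - lorentz y z; set C := - lorentz x z.
move=> C1 B1 A1.
have A2 : 0 <= A ^+ 2 - 1 by rewrite subr_ge0 expr_ge1//; lra.
have B2 : 0 <= B ^+ 2 - 1 by rewrite subr_ge0 expr_ge1//; lra.
have sE := sqr_sqrtr A2; have tE := sqr_sqrtr B2.
have := sqrtr_ge0 (A ^+ 2 - 1); have := sqrtr_ge0 (B ^+ 2 - 1).
move: sE tE; set s := Num.sqrt (A ^+ 2 - 1); set t := Num.sqrt (B ^+ 2 - 1).
move=> sE tE t0 s0.
have CD : C <= A * B + s * t.
  pose u := (x : 'rV[R]_d.+1) + (- A) *: (y : 'rV[R]_d.+1).
  pose v := (z : 'rV[R]_d.+1) + (- B) *: (y : 'rV[R]_d.+1).
  have xyE : lorentz x y = - A by rewrite opprK.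
  have yzE : lorentz y z = - B by rewrite opprK.
  have xzE : lorentz x z = - C by rewrite opprK.
  have uy : lorentz u y = 0.
    by rewrite lorentzDl lorentzZl hspace_lorentz xyE; ring.
  have vy : lorentz v y = 0.
    by rewrite lorentzDl lorentzZl hspace_lorentz lorentzC yzE; ring.
  have := lorentz_CS uy vy.
  have -> : lorentz u v = A * B - C.
    rewrite !(lorentzDl, lorentzDr, lorentzZl, lorentzZr) hspace_lorentz.
    by rewrite xyE yzE xzE; ring.
  have -> : lorentz u u = s ^+ 2.
    rewrite !(lorentzDl, lorentzDr, lorentzZl, lorentzZr) !hspace_lorentz.
    by rewrite (lorentzC y x) xyE sE; ring.
  have -> : lorentz v v = t ^+ 2.
    rewrite !(lorentzDl, lorentzDr, lorentzZl, lorentzZr) !hspace_lorentz.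
    by rewrite (lorentzC z y) yzE tE; ring.
  have [|CAB] := leP C (A * B); first by have := mulr_ge0 s0 t0; lra.
  rewrite -exprMn -sqrrN ler_pXn2r// ?nnegrE ?mulr_ge0//; last by lra.
  by rewrite opprB; lra.
have AB0 : 0 <= A * t + B * s by rewrite addr_ge0// mulr_ge0//; lra.
have rC : Num.sqrt (C ^+ 2 - 1) <= A * t + B * s.
  rewrite -[leRHS]ger0_norm// -sqrtr_sqr ler_wsqrtr//.
  have -> : (A * t + B * s) ^+ 2 = (A * B + s * t) ^+ 2 - 1.
    rewrite !sqrrD !exprMn sE tE; ring.
  rewrite lerD2r ler_pXn2r// nnegrE; [lra|].
  by rewrite addr_ge0// mulr_ge0//; lra.
have := sqrtr_ge0 (C ^+ 2 - 1) => rC0.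
rewrite -lnM ?posrE; [|lra|lra].
rewrite ler_ln ?posrE; [|lra|by rewrite mulr_gt0//; lra].
have -> : (A + s) * (B + t) = (A * B + s * t) + (A * t + B * s) by ring.
exact: lerD.
Qed.

End hdist_metric.

HB.instance Definition _ (R : realType) (d : nat) :=
  @isMetric.Build R (hspace R d) (@hdist R d) (@hdistxx R d)
    (@hdist_eq0 R d) (@hdistC R d) (@hdist_triangle R d).

(* The geodesic segments joining a to b are the images of the isometric
   parametrizations g of [0, |ab|] with g 0 = a and g |ab| = b. *)
Definition geodesic_arc (R : realType) (d : nat) (a b : hspace R d)
    (g : R -> hspace R d) : Prop :=
  [/\ g 0 = a, g (mdist a b) = b &
      {in `[0, mdist a b] &, forall s t, mdist (g s) (g t) = `|s - t|}].

Definition geodesic_segment (R : realType) (d : nat) (a b : hspace R d) :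
    set (hspace R d) :=
  [set z | exists2 g, geodesic_arc a b g & (g @` `[0, mdist a b]) z].

Definition hconvex (R : realType) (d : nat) (C : set (hspace R d)) : Prop :=
  forall a b, C a -> C b -> geodesic_segment a b `<=` C.

Definition hbounded (R : realType) (d : nat) (C : set (hspace R d)) : Prop :=
  exists p r, C `<=` ball p r.

Definition convex_body (R : realType) (d : nat) (C : set (hspace R d)) : Prop :=
  [/\ closed C, hbounded C, hconvex C & C° !=set0].

(* A hyperplane is the trace on the hyperboloid of the Lorentz-orthogonal
   complement of a spacelike vector; proportional normals present the same
   hyperplane. *)
Record hyperplane (R : realType) (d : nat) := Hyperplane {
  normal : 'rV[R]_d.+1;
  normal_spacelike : 0 < lorentz normal normal
}.

Definition hyperplane_set (R : realType) (d : nat) (H : hyperplane R d) :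
    set (hspace R d) :=
  [set x | lorentz x (normal H) = 0].

Coercion hyperplane_set : hyperplane >-> set.

(* Points at infinity of H^d are the rays of future-directed lightlike
   vectors; each is given here by any of its representatives. *)
Definition lightlike (R : realType) (d : nat) : set 'rV[R]_d.+1 :=
  [set p | lorentz p p = 0 /\ 0 < p 0 0].

Definition hyperplane_infty (R : realType) (d : nat) (H : hyperplane R d) :
    set 'rV[R]_d.+1 :=
  @lightlike R d `&` [set p | lorentz p (normal H) = 0].

Definition ultraparallel (R : realType) (d : nat) (H J : hyperplane R d) :
    Prop :=
  H `&` J = set0 /\ hyperplane_infty H `&` hyperplane_infty J = set0.

Definition supports (R : realType) (d : nat) (H : hyperplane R d)
    (C : set (hspace R d)) : Prop :=
  H `&` C !=set0 /\ H `&` C° = set0.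

Definition dist (R : realType) (d : nat) (A B : set (hspace R d)) : R :=
  inf [set mdist a b | a in A & b in B].

Definition farthest_supporting (R : realType) (d : nat) (H : hyperplane R d)
    (C : set (hspace R d)) (J : hyperplane R d) : Prop :=
  [/\ ultraparallel J H, supports J C &
      forall J' : hyperplane R d, ultraparallel J' H -> supports J' C ->
        dist H J' <= dist H J].

(* The width is the value common to all farthest J; it is kept relational since
   neither the existence of a farthest J nor the uniqueness of the value is
   known a priori. *)
Definition is_width (R : realType) (d : nat) (H : hyperplane R d)
    (C : set (hspace R d)) (w : R) : Prop :=
  exists2 J : hyperplane R d, farthest_supporting H C J & w = dist H J.

Definition is_maximum (R : realType) (D : set R) (m : R) : Prop :=
  D m /\ ubound D m.

(* Main.v *)
Require Import Defs.
From mathcomp Require Import all_boot all_order all_algebra.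
From mathcomp Require Import all_classical all_reals all_analysis.
From mathcomp Require Import ring lra.

Set Implicit Arguments.
Unset Strict Implicit.
Unset Printing Implicit Defensive.

Import Order.TTheory GRing.Theory Num.Theory.
Import numFieldNormedType.Exports.

Local Open Scope classical_set_scope.
Local Open Scope ring_scope.

(** Write [<u, v>] for the Lorentz form and let [e] be a unit normal of [H].
    If [y] is a point then [<y, e>] is, up to sign, the hyperbolic sine of its
    distance from [H], so that this distance is an increasing function of
    [|<y, e>|] ([dist_point_hyperplane]); it is realized by the foot of the
    perpendicular ([hyperplane_foot]), and the lower bound is the
    Cauchy-Schwarz inequality in the tangent space of a point of [H].

    A closed bounded set is compact, so some [c] in [C] maximizes [|<x, e>|]
    over [C] ([max_lorentz_ex]); the sign of [e] is chosen so that
    [t := <c, e>] is nonnegative. It is positive because an interior point of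
    [C] lies off [H]. Let [s] be the distance from [c] to [H]; it is the
    largest distance from [H] to a point of [C].

    - Any hyperplane supporting [C] has a point in [C], hence lies at distance
      at most [s] from [H].
    - Let [J] be the hyperplane through [c] perpendicular to the perpendicular
      from [c] to [H] ([tangent_hyperplane]). Its normal is [e + t c], and its
      points [x] are those with [<x, e> = t cosh |xc|] ([in_tangent]).
      As [cosh >= 1], they satisfy [<x, e> >= t], so [J] is at distance
      exactly [s] from [H], and every point of [C] on [J] maximizes [<x, e>]
      over [C]; such a point is never interior ([max_not_interior]), so [J]
      supports [C]. A vector orthogonal to both [e] and [e + t c] is orthogonal
      to the timelike [c], so it is neither a point nor an ideal point:
      [J] and [H] are ultraparallel ([tangent_ultraparallel]).

    Hence [J] is a farthest supporting hyperplane, and every farthest one is at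
    distance [s]. *)

(** * The inverse hyperbolic cosine *)

Section arcosh_theory.
Context (R : realType).
Implicit Types a b t : R.

Lemma le_arcosh a b : 1 <= a -> a <= b -> arcosh a <= arcosh b.
Proof.
move=> a1 ab; rewrite /arcosh.
have sa := sqrtr_ge0 (a ^+ 2 - 1); have sb := sqrtr_ge0 (b ^+ 2 - 1).
rewrite ler_ln ?posrE; [|lra|lra].
by rewrite lerD// ler_wsqrtr// lerD2r ler_pXn2r// nnegrE; lra.
Qed.

Lemma le_expR_arcosh a : 1 <= a -> a <= expR (arcosh a).
Proof.
move=> a1; have sa := sqrtr_ge0 (a ^+ 2 - 1).
by rewrite /arcosh lnK ?posrE; lra.
Qed.

(** The last hypothesis is [a < cosh t]. *)
Lemma arcosh_lt a t : 0 < t -> 1 <= a ->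
  2 * expR t * a < expR t ^+ 2 + 1 -> arcosh a < t.
Proof.
move=> t0 a1; have := expR_gt1 t; rewrite t0 -[in arcosh a < t](expRK t).
set E := expR t => E1 aE.
have sa := sqrtr_ge0 (a ^+ 2 - 1).
have aEE : a < E by nra.
rewrite /arcosh ltr_ln ?posrE; [|lra|lra].
suff : Num.sqrt (a ^+ 2 - 1) < E - a by lra.
rewrite -(@ltr_pXn2r _ 2)// ?nnegrE; [|lra].
by rewrite sqr_sqrtr; nra.
Qed.

(** As [cosh (arsinh t) = sqrt (1 + t ^+ 2)], both sides are [arsinh] of
    an absolute value. *)
Lemma le_arcosh_sqrt a b : `|a| <= `|b| ->
  arcosh (Num.sqrt (1 + a ^+ 2)) <= arcosh (Num.sqrt (1 + b ^+ 2)).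
Proof.
move=> ab; apply: le_arcosh.
  by rewrite -[leLHS]sqrtr1 ler_wsqrtr// lerDl sqr_ge0.
rewrite ler_wsqrtr// lerD2l -(real_normK (num_real a)).
by rewrite -(real_normK (num_real b)) ler_pXn2r ?nnegrE.
Qed.

End arcosh_theory.

(** * Points and hyperplanes of the hyperboloid *)

Section hyperboloid.
Context (R : realType) (d : nat).
Implicit Types (u v p e : 'rV[R]_d.+1) (x y z a c f : hspace R d).

(** The reversed Cauchy-Schwarz phenomenon: a future vector, timelike or
    lightlike, is never orthogonal to a point. *)
Lemma lorentz_causal_lt0 x p :
  lorentz p p <= 0 -> 0 < p 0 0 -> lorentz p x < 0.
Proof.
move=> pp p0; have x0 := hspace_gt0 x; have := hspace_lorentz x.
move: pp; rewrite /lorentz.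
under eq_bigr do rewrite -expr2.
under [X in X - _ = _]eq_bigr do rewrite -expr2.
have := euclid_CS (fun i => p 0 (lift ord0 i))
   (fun i => (x : 'rV[R]_d.+1) 0 (lift ord0 i)).
set S := \sum_i _; set P := \sum_i _; set X := \sum_i _ => CS pp xx.
have P0 : 0 <= P by apply: sumr_ge0 => i _; exact: sqr_ge0.
rewrite subr_lt0.
have [S0|S0] := ltP S 0; first by rewrite (lt_trans S0)// mulr_gt0.
rewrite -(@ltr_pXn2r _ 2)// ?nnegrE//; last by rewrite ltW// mulr_gt0.
apply: (le_lt_trans CS); rewrite exprMn.
have X0 : 0 <= X by apply: sumr_ge0 => i _; exact: sqr_ge0.
have -> : (x : 'rV[R]_d.+1) 0 0 ^+ 2 = X + 1 by rewrite expr2; lra.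
apply: (@le_lt_trans _ _ (p 0 0 ^+ 2 * X)).
  by rewrite ler_wpM2r// expr2; lra.
by rewrite ltr_pM2l ?exprn_gt0// ltrDl.
Qed.

(** Being on the upper sheet need not be checked on the time coordinate: it is
    enough that [u] pairs negatively with one known point. *)
Lemma hspace_of_unit_timelike x u :
  lorentz u u = -1 -> lorentz u x < 0 -> {y : hspace R d | y = u :> 'rV_d.+1}.
Proof.
move=> uu ux; suff h : (lorentz u u == -1) && (0 < u 0 0) by exists (HPoint h).
rewrite uu eqxx/= ltNge; apply/negP; rewrite le_eqVlt => /orP[/eqP u0|u0].
  have : 0 <= lorentz u u.
    rewrite /lorentz u0 mul0r subr0; apply: sumr_ge0 => i _.
    by rewrite -expr2 sqr_ge0.
  by rewrite uu; lra.
have := @lorentz_causal_lt0 x (-1 *: u).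
rewrite !(lorentzZl, lorentzZr) !mxE uu => /(_ _ _).
by move=> /(_ ltac:(lra) ltac:(lra)); lra.
Qed.

(** Project [y] and [e] to the tangent space at [a], where the form is positive
    definite: [y] becomes a vector of square norm [cosh |ya| ^+ 2 - 1], while
    [e] is already tangent, so Cauchy-Schwarz applies. *)
Lemma sqrt_le_cosh_hdist e a y : lorentz e e = 1 -> lorentz a e = 0 ->
  Num.sqrt (1 + lorentz y e ^+ 2) <= - lorentz y a.
Proof.
move=> ee ae.
pose u := (y : 'rV[R]_d.+1) + lorentz y a *: (a : 'rV[R]_d.+1).
have ua : lorentz u a = 0 by rewrite lorentzDl lorentzZl hspace_lorentz; ring.
have ea : lorentz e a = 0 by rewrite lorentzC.
have := lorentz_CS ua ea.
rewrite ee !(lorentzDl, lorentzDr, lorentzZl, lorentzZr) !hspace_lorentz ae.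
rewrite (lorentzC a y) => h.
have y1 := hspace_lorentz_le y a.
rewrite -[leRHS]ger0_norm; last by lra.
by rewrite -sqrtr_sqr ler_wsqrtr//; lra.
Qed.

(** The foot is the projection [y - <y, e> e] of [y] to the orthogonal
    complement of [e], rescaled to the hyperboloid. *)
Lemma hyperplane_foot e y : lorentz e e = 1 ->
  exists f, lorentz f e = 0 /\ - lorentz y f = Num.sqrt (1 + lorentz y e ^+ 2).
Proof.
move=> ee; set t := lorentz y e; set s := Num.sqrt _.
have t2 := sqr_ge0 t.
have s2 : s ^+ 2 = 1 + t ^+ 2 by rewrite sqr_sqrtr//; lra.
have s0 : 0 < s by rewrite sqrtr_gt0; lra.
have sn : s != 0 by rewrite gt_eqF.
pose u : 'rV[R]_d.+1 := s^-1 *: ((y : 'rV[R]_d.+1) + (- t) *: e).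
have uyE : lorentz u y = - s.
  rewrite lorentzZl lorentzDl lorentzZl hspace_lorentz (lorentzC e) -/t.
  have -> : -1 + - t * t = - s ^+ 2 by rewrite s2; ring.
  by field.
have uu : lorentz u u = -1.
  rewrite !(lorentzZl, lorentzZr, lorentzDl, lorentzDr) hspace_lorentz ee.
  rewrite (lorentzC e) -/t.
  have -> : - t * t = 1 - s ^+ 2 by rewrite s2; ring.
  by field.
have [|f fu] := hspace_of_unit_timelike uu (x := y); first by rewrite uyE; lra.
exists f; rewrite (lorentzC y) fu uyE opprK; split=> //.
by rewrite lorentzZl lorentzDl lorentzZl ee -/t; ring.
Qed.

Lemma mdistE x y : mdist x y = arcosh (- lorentz x y).
Proof. by []. Qed.

Lemma dist_le (A B : set (hspace R d)) x y :
  A x -> B y -> dist A B <= mdist x y.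
Proof.
move=> Ax By; apply: ge_inf; last by exists x => //; exists y.
by exists 0 => _ [? _ [? _ <-]]; exact: mdist_ge0.
Qed.

Lemma dist_ge (A B : set (hspace R d)) (m : R) : A !=set0 -> B !=set0 ->
  (forall x y, A x -> B y -> m <= mdist x y) -> m <= dist A B.
Proof.
move=> [x Ax] [y By] h; apply: lb_le_inf.
  by exists (mdist x y), x => //; exists y.
by move=> _ [? ? [? ? <-]]; exact: h.
Qed.

(** The second clause only asks that [e] and the given normal have the same
    orthogonal complement, so that [- e] qualifies whenever [e] does. *)
Definition unit_normal e (H : hyperplane R d) :=
  lorentz e e = 1 /\ forall v, lorentz v (normal H) = 0 <-> lorentz v e = 0.

Lemma unit_normal_ex (H : hyperplane R d) : exists e, unit_normal e H.
Proof.
have n0 := normal_spacelike H; set n := normal H in n0 *.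
have s0 : 0 < Num.sqrt (lorentz n n) by rewrite sqrtr_gt0.
have sn : Num.sqrt (lorentz n n) != 0 by rewrite gt_eqF.
exists ((Num.sqrt (lorentz n n))^-1 *: n); split=> [|v].
  rewrite lorentzZl lorentzZr -[X in _ * (_ * X)](sqr_sqrtr (ltW n0)).
  by field.
rewrite lorentzZr; split=> [->|/eqP]; first by rewrite mulr0.
by rewrite mulf_eq0 invr_eq0 (negbTE sn) => /eqP.
Qed.

Lemma hyperplane_nonempty e (H : hyperplane R d) y :
  unit_normal e H -> H !=set0.
Proof.
by move=> [ee He]; have [f [fe _]] := hyperplane_foot y ee; exists f; apply/He.
Qed.

Lemma dist_point_hyperplane e (H : hyperplane R d) y : unit_normal e H ->
  dist [set y] H = arcosh (Num.sqrt (1 + lorentz y e ^+ 2)).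
Proof.
move=> [ee He]; have [f [fe fy]] := hyperplane_foot y ee.
have fH : hyperplane_set H f by apply/He.
apply/eqP; rewrite eq_le -{1}fy -mdistE dist_le//=.
apply: dist_ge; [by exists y|by exists f|move=> _ a -> /He ae].
rewrite mdistE le_arcosh ?sqrt_le_cosh_hdist//.
by rewrite -[leLHS]sqrtr1 ler_wsqrtr// lerDl sqr_ge0.
Qed.

(** * Compactness of closed bounded sets *)

Lemma lorentz_continuous (f g : 'rV[R]_d.+1 -> 'rV[R]_d.+1) :
  continuous f -> continuous g -> continuous (fun u => lorentz (f u) (g u)).
Proof.
move=> cf cg.
have coordM j : continuous (fun v => f v 0 j * g v 0 j).
  move=> v; apply: continuousM.
    by apply: (continuous_comp (f := f) (g := fun M : 'rV[R]_d.+1 => M 0 j));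
      [exact: cf|exact: coord_continuous].
  by apply: (continuous_comp (f := g) (g := fun M : 'rV[R]_d.+1 => M 0 j));
    [exact: cg|exact: coord_continuous].
have S : continuous
    (fun v => \sum_(i < d) f v 0 (lift ord0 i) * g v 0 (lift ord0 i)).
  by apply: (continuous_big (op := +%R)) => [|i _];
    [exact: add_continuous|exact: coordM].
move=> u; exact: (continuousB (S u) (coordM 0 u)).
Qed.

Lemma lorentzl_continuous e : continuous (fun u => lorentz u e).
Proof.
apply: (@lorentz_continuous id (cst e)) => u; first exact: cvg_id.
exact: cst_continuous.
Qed.

Lemma sqr_coord_le x j :
  (x : 'rV[R]_d.+1) 0 j ^+ 2 <= (x : 'rV[R]_d.+1) 0 0 ^+ 2.
Proof.
case: (unliftP ord0 j) => [i ->|->//].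
have := hspace_lorentz x; rewrite /lorentz.
under eq_bigr do rewrite -expr2.
rewrite (bigD1 i)//=; set s := \sum_(_ | _) _.
have : 0 <= s by apply: sumr_ge0 => k _; exact: sqr_ge0.
by move=> s0 xx; rewrite [leRHS]expr2; lra.
Qed.

Lemma origin_subproof :
  let o : 'rV[R]_d.+1 := delta_mx 0 0 in (lorentz o o == -1) && (0 < o 0 0).
Proof.
rewrite /lorentz big1 => [|i _]; rewrite !mxE/= ?mulr0//.
by rewrite sub0r mulr1 eqxx ltr01.
Qed.

Definition origin : hspace R d := HPoint origin_subproof.

Lemma lorentz_origin x : - lorentz x origin = (x : 'rV[R]_d.+1) 0 0.
Proof.
rewrite /lorentz big1 => [|i _]; rewrite /= !mxE/= ?mulr0//.
by rewrite mulr1 sub0r opprK.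
Qed.

(** The time coordinate of [x] is [cosh] of its distance to the origin of the
    hyperboloid, and it dominates the other coordinates. *)
Lemma hbounded_coord (C : set (hspace R d)) : hbounded C ->
  exists B, forall x j, C x -> `|(x : 'rV[R]_d.+1) 0 j| <= B.
Proof.
move=> [p [r Cr]]; exists (expR (r + mdist p origin)) => x j /Cr.
rewrite ballEmdist/= => pxr; have x0 := hspace_gt0 x.
apply: (@le_trans _ _ ((x : 'rV[R]_d.+1) 0 0)).
  rewrite -[leRHS]gtr0_norm// -(@ler_pXn2r _ 2) ?nnegrE//.
  by rewrite !real_normK ?num_real// sqr_coord_le.
rewrite -lorentz_origin; apply: le_trans (le_expR_arcosh _) _.
  exact: hspace_lorentz_le.
rewrite -mdistE ler_expR (le_trans (metric_triangle x p _))// lerD2r.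
by rewrite metric_sym ltW.
Qed.

(** The hyperboloid is closed in Minkowski space, and near a point of it the
    hyperbolic balls contain the traces of coordinate neighbourhoods. *)
Lemma closed_hcoord (C : set (hspace R d)) : closed C ->
  closed [set hcoord x | x in C].
Proof.
move=> cC u uC.
have cld (P : set R) (g : 'rV[R]_d.+1 -> R) : closed P -> continuous g ->
   (forall x : hspace R d, P (g x)) -> P (g u).
  move=> cP cg Px.
  have : closed (g @^-1` P) by apply: closed_comp => // ? _; exact: cg.
  apply; apply: closure_subset uC => _ [x _ <-]; exact: Px.
have uu : lorentz u u = -1.
  apply: (cld [set -1] (fun v => lorentz v v)).
  - exact: closed_eq.
  - by apply: (@lorentz_continuous id id) => v; exact: cvg_id.
  - by move=> x; exact: hspace_lorentz.
(* This bound, closed unlike [0 < u 0 0], keeps [u] on the upper sheet. *)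
have uo : lorentz u origin <= -1.
  apply: (cld [set t | t <= -1] (fun v => lorentz v origin)).
  - exact: closed_le.
  - exact: lorentzl_continuous.
  - by move=> x /=; have := hspace_lorentz_le x origin; lra.
have [|z zu] := hspace_of_unit_timelike uu (x := origin); first by lra.
exists z => //; apply: cC => V; rewrite nbhs_ballP => -[eps /= eps0 zV].
have E1 : 1 < expR eps by rewrite expR_gt1.
set E := expR eps in E1.
(* The bound is [- cosh eps]. *)
have : \forall v \near u, - ((E ^+ 2 + 1) / (2 * E)) < lorentz v z.
  have /cvgr_gt := @lorentzl_continuous z u; apply.
  rewrite zu uu ltrN2 ltr_pdivlMr; last by lra.
  by nra.
move=> /uC [_ [[x Cx <-] /= xz]]; exists x; split => //; apply: zV.
rewrite ballEmdist/= metric_sym mdistE arcosh_lt//; first exact: hspace_lorentz_le.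
move: xz; rewrite ltrNl ltr_pdivlMr -/E; last by lra.
by lra.
Qed.

Lemma compact_hcoord (C : set (hspace R d)) : closed C -> hbounded C ->
  compact [set hcoord x | x in C].
Proof.
move=> cC /hbounded_coord[B CB].
apply: (subclosed_compact (closed_hcoord cC)
  (rV_compact (fun=> @segment_compact R (- B) B))).
by move=> _ [x Cx <-] j; rewrite /= in_itv/= -ler_norml CB.
Qed.

Lemma max_lorentz_ex (C : set (hspace R d)) e :
  closed C -> hbounded C -> C !=set0 ->
  exists2 c, C c & forall x, C x -> `|lorentz x e| <= `|lorentz c e|.
Proof.
move=> cC bC [x0 Cx0].
have [||_ /set_mem[c Cc <-] cmax] := @EVT_max_rV R _
    (fun u => `|lorentz u e|) _ _ (compact_hcoord cC bC).
- by exists x0, x0.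
- apply: continuous_subspaceT => u.
  apply: (@continuous_comp _ _ _ (fun u => lorentz u e) Num.norm).
    exact: lorentzl_continuous.
  exact: norm_continuous.
- by exists c => // x Cx; apply: cmax; apply/mem_set; exists x.
Qed.

(** * The hyperplane through a point of maximal height *)

(** Moving from [c] along the perpendicular to the hyperplane orthogonal to [e]
    strictly increases [<x, e>], so every ball around [c] leaves [C]. *)
Lemma max_not_interior (C : set (hspace R d)) e c :
  lorentz e e = 1 -> 0 <= lorentz c e ->
  (forall x, C x -> lorentz x e <= lorentz c e) -> ~ C° c.
Proof.
move=> ee t0 cmax; rewrite /interior nbhs_ballP => -[eps /= eps0 cC].
set t := lorentz c e in t0 cmax.
have E1 : 1 < expR eps by rewrite expR_gt1.
set E := expR eps in E1.
pose K := (E ^+ 2 + 1) / (2 * E).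
have K1 : 1 < K by rewrite /K ltr_pdivlMr; [nra|lra].
(* [K = cosh eps]; the displaced point [u] below is at distance [arcosh A]
   from [c], and [k] is what puts it on the hyperboloid. *)
pose A := (1 + K) / 2.
have A1 : 1 < A by rewrite /A; lra.
have t2 := sqr_ge0 t.
have q0 : 0 < (A ^+ 2 - 1) / (1 + t ^+ 2) by rewrite divr_gt0//; nra.
pose k := Num.sqrt ((A ^+ 2 - 1) / (1 + t ^+ 2)).
have k0 : 0 < k by rewrite sqrtr_gt0.
have k2 : k ^+ 2 * (1 + t ^+ 2) = A ^+ 2 - 1.
  by rewrite sqr_sqrtr ?ltW// divfK// gt_eqF//; lra.
pose u : 'rV[R]_d.+1 := (A + k * t) *: (c : 'rV[R]_d.+1) + k *: e.
have uc : lorentz u c = - A.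
  by rewrite lorentzDl !lorentzZl hspace_lorentz (lorentzC e) -/t; ring.
have uu : lorentz u u = -1.
  rewrite !(lorentzDl, lorentzDr, lorentzZl, lorentzZr) hspace_lorentz ee.
  by rewrite (lorentzC e) -/t; lra.
have [|x xu] := hspace_of_unit_timelike uu (x := c); first by rewrite uc; lra.
suff /cmax : C x.
  rewrite xu lorentzDl !lorentzZl ee -/t.
  have : 0 <= (A - 1) * t by rewrite mulr_ge0//; lra.
  have : 0 <= k * t ^+ 2 by rewrite mulr_ge0// ltW.
  by lra.
apply: cC; rewrite ballEmdist/= metric_sym mdistE arcosh_lt ?xu ?uc//; first by lra.
have : A < K by rewrite /A; lra.
by rewrite /K ltr_pdivlMr ?opprK -/E; lra.
Qed.

Section tangent.
Variables (e : 'rV[R]_d.+1) (c : hspace R d).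
Hypothesis ee : lorentz e e = 1.

(** The component of [e] tangent to the hyperboloid at [c]. *)
Let m : 'rV[R]_d.+1 := e + lorentz c e *: (c : 'rV[R]_d.+1).

Let m_spacelike : 0 < lorentz m m.
Proof.
rewrite !(lorentzDl, lorentzDr, lorentzZl, lorentzZr) hspace_lorentz ee.
by rewrite (lorentzC e); nra.
Qed.

Definition tangent_hyperplane : hyperplane R d := Hyperplane m_spacelike.

Lemma in_tangent x : hyperplane_set tangent_hyperplane x <->
  lorentz x e = lorentz c e * - lorentz x c.
Proof.
rewrite /hyperplane_set/= /m lorentzDr lorentzZr; split=> h; lra.
Qed.

End tangent.

End hyperboloid.

(** A common point, real or ideal, would be orthogonal to [c]: this is where
    [<c, e> <> 0] matters, as otherwise both hyperplanes pass through [c]. *)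
Lemma tangent_ultraparallel (R : realType) (d : nat) e (c : hspace R d)
    (ee : lorentz e e = 1) (t0 : 0 < lorentz c e) (H : hyperplane R d) :
  unit_normal e H -> ultraparallel (tangent_hyperplane c ee) H.
Proof.
move=> [_ He].
have key p : lorentz p (normal (tangent_hyperplane c ee)) = 0 ->
    lorentz p (normal H) = 0 -> lorentz p c = 0.
  move=> + /He pe; rewrite /= lorentzDr lorentzZr pe add0r => /eqP.
  by rewrite mulf_eq0 (gt_eqF t0)/= => /eqP.
split; rewrite -subset0.
- move=> x [/key/[apply]]; have := hspace_lorentz_le x c => + xc.
  by rewrite xc; lra.
- move=> p [[[pp p0] pJ] [_ pH]].
  have := @lorentz_causal_lt0 _ _ c p; rewrite pp lexx (key p pJ pH) ltxx.
  by move=> /(_ isT p0).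
Qed.

Theorem proposition1 (R : realType) (d : nat) (C : set (hspace R d))
    (H : hyperplane R d) (hC : convex_body C) (hH : supports H C) :
  (exists w : R, is_width H C w) /\
  (forall w : R, is_width H C w ->
     is_maximum [set dist [set c] H | c in C] w).
Proof.
case: hC => cC bC _ [i Ci]; have Ci' := interior_subset Ci.
have [e0 H0] := unit_normal_ex H.
have [c Cc cmax0] := max_lorentz_ex e0 cC bC (ex_intro _ i Ci').
have [e [He t0 cmax]] : exists e, [/\ unit_normal e H, 0 <= lorentz c e &
    forall x, C x -> `|lorentz x e| <= lorentz c e].
  have [ce|ce] := leP 0 (lorentz c e0).
    by exists e0; split => // x /cmax0; rewrite (ger0_norm ce).
  have N u : lorentz u (-1 *: e0) = - lorentz u e0 by rewrite lorentzZr mulN1r.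
  exists (-1 *: e0); split; [split|by rewrite N; lra|].
  - by rewrite N lorentzC N opprK; have [] := H0.
  - move=> v; rewrite N; case: H0 => _ ->; split=> [->|/eqP]; first by rewrite oppr0.
    by rewrite oppr_eq0 => /eqP.
  - by move=> x /cmax0; rewrite !N normrN (ltr0_norm ce).
have ee := He.1.
(* Otherwise all of [C] lies on [H], which misses the interior point [i]. *)
have {}t0 : 0 < lorentz c e.
  rewrite lt_neqAle t0 andbT eq_sym; apply/eqP => ce.
  have : (H `&` C°) i.
    have := cmax _ Ci'; rewrite ce normr_le0 => /eqP ie.
    by split => //; have [_ He2] := He; apply/He2.
  by case: hH => _ ->.
pose J := tangent_hyperplane c ee.
pose s := arcosh (Num.sqrt (1 + lorentz c e ^+ 2)).
have cs : dist [set c] H = s by exact: dist_point_hyperplane.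
have Cs x : C x -> dist [set x] H <= s.
  move=> Cx; rewrite (dist_point_hyperplane _ He) le_arcosh_sqrt//.
  by rewrite (gtr0_norm t0) cmax.
have dist_tr x (J' : set (hspace R d)) : J' x -> dist H J' <= dist [set x] H.
  move=> Jx; have [f Hf] := hyperplane_nonempty x He.
  apply: dist_ge; [by exists x|by exists f|move=> _ y -> Hy].
  by rewrite metric_sym; exact: dist_le.
have Jc : hyperplane_set J c by apply/in_tangent; rewrite hspace_lorentz; ring.
have HJ : dist H J = s.
  apply/eqP; rewrite eq_le -{1}cs dist_tr//=.
  have [f Hf] := hyperplane_nonempty c He.
  apply: dist_ge; [by exists f|by exists c|move=> x y Hx /in_tangent yJ].
  apply: (@le_trans _ _ (dist [set y] H)).
    rewrite (dist_point_hyperplane _ He) le_arcosh_sqrt// yJ.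
    rewrite normrM ler_peMr//.
    by rewrite ger0_norm; have := hspace_lorentz_le y c; lra.
  by rewrite metric_sym; exact: dist_le.
have JC : supports J C.
  split; first by exists c.
  rewrite -subset0 => x [/in_tangent xJ Cx].
  have Cx' := interior_subset Cx.
  have xc : lorentz c e <= lorentz x e.
    by rewrite xJ ler_peMr ?hspace_lorentz_le// ltW.
  apply: (max_not_interior ee _ _ Cx); first by lra.
  by move=> y Cy; apply: le_trans xc; apply: le_trans (cmax _ Cy); exact: ler_norm.
have Jup : ultraparallel J H := tangent_ultraparallel ee t0 He.
have wid J' : supports J' C -> dist H J' <= s.
  by move=> [[x [J'x Cx]] _]; apply: le_trans (Cs _ Cx); exact: dist_tr.
split; first by exists s, J => //; split=> // J' _ /wid; rewrite HJ.
move=> w [J' [_ J'C J'max] ->].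
have -> : dist H J' = s by apply/eqP; rewrite eq_le wid//= -HJ J'max.
by split; [exists c|move=> _ [x Cx <-]; exact: Cs].
Qed.
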